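(* Let $S$ be a straight left I-order in an inverse semigroup $Q$. Let $a,b,c,d\in S$ with $a\,\mathcal{R}^Q\,b$ and $c\,\mathcal{R}^Q\,d$. Then $a^{-1}b=c^{-1}d$ if and only if there exist $x,y\in S$ with $xa=yc$ and $xb=yd$ and such that $a\,\mathcal{R}^Q\,x^{-1}$, $x\,\mathcal{R}^Q\,y$ and $y\,\mathcal{L}^Q\,c^{-1}$.
   Context: $\mathcal{R}^Q$ and $\mathcal{L}^Q$ are Green's relations on $Q$, and $a^{-1}$ denotes the inverse of $a$ in the inverse semigroup $Q$. A subsemigroup $S$ of an inverse semigroup $Q$ is a straight left I-order in $Q$ if every $q\in Q$ can be written as $q=a^{-1}b$ with $a,b\in S$ and $a\,\mathcal{R}^Q\,b$. *)

(* Defs.v *)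
From HB Require Import structures.
From mathcomp Require Import all_boot.
From mathcomp Require Import monoid boolp classical_sets.

Set Implicit Arguments.
Unset Strict Implicit.
Unset Printing Implicit Defensive.

Local Open Scope classical_set_scope.
Local Open Scope group_scope.

Definition mutually_inverse (T : semigroupType) (a b : T) : Prop :=
  a * b * a = a /\ b * a * b = b.

(* MathComp's own inverse operation lives in a structure with a unit, which an
   inverse semigroup need not have; hence a separate operation [isinv]. *)
HB.mixin Record Semigroup_isInverse Q of Semigroup Q := {
  isinv : Q -> Q;
  isinvP : forall a : Q, mutually_inverse a (isinv a);
  isinv_unique : forall a b : Q, mutually_inverse a b -> b = isinv a
}.

#[short(type="inverseSemigroupType")]
HB.structure Definition InverseSemigroup :=
  {Q of Semigroup_isInverse Q & Semigroup Q}.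

Declare Scope isg_scope.
Delimit Scope isg_scope with isg.
(* Without the delimiters, the arguments of [mul] would be read in [group_scope],
   where ^-1 is the inverse of a group. *)
Notation "x * y" := (mul x%isg y%isg) : isg_scope.
Notation "x ^-1" := (isinv x) : isg_scope.

(* The principal one-sided ideals a Q^1 and Q^1 a, where Q^1 is Q with an
   identity adjoined if necessary. *)
Definition principal_right_ideal (Q : semigroupType) (a : Q) : set Q :=
  [set x | x = a \/ exists q : Q, x = a * q].

Definition principal_left_ideal (Q : semigroupType) (a : Q) : set Q :=
  [set x | x = a \/ exists q : Q, x = q * a].

Definition greenR (Q : semigroupType) (a b : Q) : Prop :=
  principal_right_ideal a = principal_right_ideal b.

Definition greenL (Q : semigroupType) (a b : Q) : Prop :=
  principal_left_ideal a = principal_left_ideal b.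

Arguments greenR {Q} (a b)%_isg.
Arguments greenL {Q} (a b)%_isg.

Definition subsemigroup (Q : semigroupType) (S : set Q) : Prop :=
  forall a b : Q, S a -> S b -> S (a * b).

Definition straight_left_I_order (Q : inverseSemigroupType) (S : set Q) : Prop :=
  subsemigroup S /\
  forall q : Q, exists a b : Q,
    [/\ S a, S b, q = (a^-1 * b)%isg & greenR a b].

(* Main.v *)
Require Import Defs.
From mathcomp Require Import all_boot.
From mathcomp Require Import monoid boolp classical_sets.

Local Open Scope isg_scope.

(** In an inverse semigroup the inverse is an involutive antimorphism, and
    Green's relations are read off idempotents: [a R b] means [a a^-1 = b b^-1]
    and [a L b] means [a^-1 a = b^-1 b] ([greenRE], [greenLE]).  Regard [a] as
    an arrow from the idempotent [a a^-1] to the idempotent [a^-1 a].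

    If [a^-1 b = c^-1 d] with [a R b] and [c R d], then the two fractions start
    at the same idempotent, so [a^-1 a = c^-1 c], and [a c^-1] is a composite of
    arrows with matching ends, from [a a^-1] to [c c^-1].  Writing it as a
    straight fraction [x^-1 y] of elements of [S] gives the required [x] and
    [y]: both idempotents of [a c^-1] can also be computed from [x^-1 y], which
    yields the two relations with [a] and [c], and the two equations follow by
    cancelling idempotents.

    Conversely, the relations say that [x] and [y] can be cancelled from
    [(x a)^-1 (x b)] and from [(y c)^-1 (y d)]. *)

Section InverseSemigroup.
Set Implicit Arguments.
Unset Strict Implicit.
Variable Q : inverseSemigroupType.
Implicit Types a b e f q u v x y : Q.

Lemma mulKinv a : a * a^-1 * a = a.
Proof. by case: (isinvP a). Qed.

Lemma invKmul a : a^-1 * a * a^-1 = a^-1.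
Proof. by case: (isinvP a). Qed.

Lemma invinv a : a^-1^-1 = a.
Proof.
by symmetry; apply: isinv_unique; split; [exact: invKmul | exact: mulKinv].
Qed.

Lemma idem_mulV a : (a * a^-1) * (a * a^-1) = a * a^-1.
Proof. by rewrite mulgA mulKinv. Qed.

Lemma idem_Vmul a : (a^-1 * a) * (a^-1 * a) = a^-1 * a.
Proof. by rewrite mulgA invKmul. Qed.

Lemma inv_idem e : e * e = e -> e^-1 = e.
Proof. by move=> ee; symmetry; apply: isinv_unique; split; rewrite !ee. Qed.

(** With [g] the inverse of [e f], the element [f g e] is another inverse of
    [e f], hence equals [g]; this form makes [g] idempotent, hence its own
    inverse, so that [g = e f]. *)
Lemma idem_mul e f : e * e = e -> f * f = f -> (e * f) * (e * f) = e * f.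
Proof.
move=> ee ff; set g := (e * f)^-1.
have [efgef gefg] : mutually_inverse (e * f) g by exact: isinvP.
have gE : f * g * e = g.
  apply: isinv_unique; split.
    rewrite !mulgA -(mulgA e f f) ff -(mulgA _ e e) ee.
    by rewrite -[RHS]efgef !mulgA.
  rewrite !mulgA -(mulgA _ e e) ee -(mulgA _ f f) ff.
  by rewrite -[in RHS]gefg !mulgA.
have gg : g * g = g.
  rewrite -{1 2}gE.
  have -> : f * g * e * (f * g * e) = f * (g * (e * f) * g) * e by rewrite !mulgA.
  by rewrite gefg.
by have <- : g = e * f by rewrite -(inv_idem gg) invinv.
Qed.

(** Both [e f] and [f e] are inverses of the idempotent [e f]. *)
Lemma idem_comm e f : e * e = e -> f * f = f -> e * f = f * e.
Proof.
move=> ee ff; have efef := idem_mul ee ff; have fefe := idem_mul ff ee.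
rewrite -[LHS](inv_idem efef); symmetry; apply: isinv_unique; split.
  by rewrite !mulgA -(mulgA e f f) ff -(mulgA _ e e) ee -[RHS]efef !mulgA.
by rewrite !mulgA -(mulgA f e e) ee -(mulgA _ f f) ff -[RHS]fefe !mulgA.
Qed.

(** Commuting the adjacent idempotents [b b^-1] and [a^-1 a] separates the
    factors belonging to [a] from those belonging to [b]. *)
Lemma inv_mul a b : (a * b)^-1 = b^-1 * a^-1.
Proof.
have comm := idem_comm (idem_mulV b) (idem_Vmul a).
symmetry; apply: isinv_unique; split.
  transitivity (a * ((b * b^-1) * (a^-1 * a)) * b); first by rewrite !mulgA.
  transitivity ((a * a^-1 * a) * (b * b^-1 * b)); first by rewrite comm !mulgA.
  by rewrite !mulKinv.
transitivity (b^-1 * ((a^-1 * a) * (b * b^-1)) * a^-1); first by rewrite !mulgA.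
transitivity ((b^-1 * b * b^-1) * (a^-1 * a * a^-1)).
  by rewrite -comm !mulgA.
by rewrite !invKmul.
Qed.

(** If [a R b] then [b b^-1] fixes [a] and [a a^-1] fixes [b] on the left, so the
    two idempotents absorb one another; since they commute, they are equal. *)
Lemma greenRE a b : greenR a b <-> a * a^-1 = b * b^-1.
Proof.
split=> [Rab | ab].
  have fix_of u v : greenR u v -> v * v^-1 * u = u.
    move=> Ruv; have : principal_right_ideal v u by rewrite -Ruv; left.
    by case=> [->|[q ->]]; rewrite ?mulgA mulKinv.
  have ba := fix_of _ _ Rab; have ab := fix_of _ _ (esym Rab).
  have baE : b * b^-1 * (a * a^-1) = a * a^-1 by rewrite mulgA ba.
  have abE : a * a^-1 * (b * b^-1) = b * b^-1 by rewrite mulgA ab.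
  by rewrite -baE (idem_comm (idem_mulV b) (idem_mulV a)) abE.
have sub u v : u * u^-1 = v * v^-1 ->
    (principal_right_ideal u `<=` principal_right_ideal v)%classic.
  move=> uv x.
  by case=> [->|[q ->]]; right; rewrite -(mulKinv u) uv -!mulgA; eexists.
by apply/seteqP; split; apply: sub.
Qed.

(** Inversion exchanges the two relations, because it exchanges left and right
    principal ideals. *)
Lemma greenL_inv a b : greenL a b <-> greenR a^-1 b^-1.
Proof.
have idealE u x : principal_left_ideal u x <->
    principal_right_ideal (u^-1)%isg (x^-1)%isg.
  split=> [[->|[q ->]]|]; [by left | by right; exists q^-1; rewrite inv_mul |].
  case=> [xu|[q xq]]; [left | right; exists q^-1].
    by rewrite -(invinv x) xu invinv.
  by rewrite -(invinv x) xq inv_mul invinv.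
split=> ab; apply/seteqP; split=> x.
- rewrite -(invinv x) => /(proj2 (idealE _ _)).
  by rewrite ab => /(proj1 (idealE _ _)).
- rewrite -(invinv x) => /(proj2 (idealE _ _)).
  by rewrite -ab => /(proj1 (idealE _ _)).
- by move/(proj1 (idealE _ _)); rewrite ab => /(proj2 (idealE _ _)).
- by move/(proj1 (idealE _ _)); rewrite -ab => /(proj2 (idealE _ _)).
Qed.

Lemma greenLE a b : greenL a b <-> a^-1 * a = b^-1 * b.
Proof. by rewrite greenL_inv greenRE !invinv. Qed.

(** The straightness hypothesis is what makes the inner idempotent cancel, so
    that the ends of [a^-1 b] are those of [a] and [b] themselves. *)
Lemma mulV_fraction a b : greenR a b -> (a^-1 * b) * (a^-1 * b)^-1 = a^-1 * a.
Proof.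
move/greenRE=> ab.
by rewrite inv_mul invinv mulgA -(mulgA _ b) -ab mulgA invKmul.
Qed.

Lemma Vmul_fraction a b : greenR a b -> (a^-1 * b)^-1 * (a^-1 * b) = b^-1 * b.
Proof.
move/greenRE=> ab.
by rewrite inv_mul invinv mulgA -(mulgA _ a) ab mulgA invKmul.
Qed.

Lemma fraction_mull x a b : x^-1 * x = a * a^-1 ->
  (x * a)^-1 * (x * b) = a^-1 * b.
Proof.
by move=> xa; rewrite inv_mul mulgA -(mulgA _ _ x) xa mulgA invKmul.
Qed.

End InverseSemigroup.

Theorem lemma2p7 (Q : inverseSemigroupType) (S : set Q)
    (hS : straight_left_I_order S)
    (a b c d : Q) (Sa : S a) (Sb : S b) (Sc : S c) (Sd : S d)
    (Rab : greenR a b) (Rcd : greenR c d) :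
  a^-1 * b = c^-1 * d <->
  exists x y : Q,
    [/\ S x, S y, x * a = y * c & x * b = y * d] /\
    [/\ greenR a (x^-1), greenR x y & greenL y (c^-1)].
Proof.
have ab := (greenRE a b).1 Rab; have cd := (greenRE c d).1 Rcd.
split=> [abcd | [x [y [[_ _ xayc xbyd] [Rax _ Lyc]]]]]; last first.
  move/greenRE: Rax; move/greenLE: Lyc; rewrite !invinv => yc ax.
  by rewrite -(fraction_mull _ (esym ax)) xayc xbyd fraction_mull.
have aLc : a^-1 * a = c^-1 * c by rewrite -(mulV_fraction Rab) abcd mulV_fraction.
have [x [y [Sx Sy acxy Rxy]]] := hS.2 (a * c^-1).
have xa : x * a = y * c.
  transitivity (x * (a * c^-1) * c).
    by rewrite -!mulgA -aLc (mulgA a) mulKinv.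
  by rewrite acxy !mulgA ((greenRE x y).1 Rxy) mulKinv.
exists x, y; split; split=> //.
- rewrite -(mulKinv b) -ab -(mulgA a) abcd !mulgA xa.
  by rewrite -!mulgA (mulgA c) cd mulKinv.
- apply/greenRE; rewrite invinv -(mulV_fraction Rxy) -acxy inv_mul invinv.
  by rewrite mulgA -(mulgA a) -aLc mulgA mulKinv.
- apply/greenLE; rewrite invinv -(Vmul_fraction Rxy) -acxy inv_mul invinv.
  by rewrite mulgA -(mulgA c) aLc mulgA mulKinv.
Qed.
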